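(* Let $d\ge1$, $0<\alpha\le1$. The set $\mathrm{span}\{\delta_x : x\in\mathbb{Q}^d\}$ is dense in $Z$ with respect to the $(\mathcal{C}^{1+\alpha}(\mathbb{R}^d))^*$-norm topology, i.e. $$Z=\overline{\mathrm{span}\{\delta_x : x\in\mathbb{Q}^d\}}^{(\mathcal{C}^{1+\alpha}(\mathbb{R}^d))^*}.$$ Consequently, $Z$ is a separable space.
   Context: $\mathcal{C}^{1+\alpha}(\mathbb{R}^d)$ is the Banach space of continuously differentiable real-valued functions on $\mathbb{R}^d$ with finite norm $$\|f\|_{\mathcal{C}^{1+\alpha}(\mathbb{R}^d)}=\sup_{x}|f(x)|+\sup_x|\nabla f(x)|+\sup_{x_1\ne x_2}\frac{|\nabla f(x_1)-\nabla f(x_2)|}{|x_1-x_2|^\alpha}.$$ $\mathcal{M}(\mathbb{R}^d)$ is the space of bounded (signed) Radon measures on $\mathbb{R}^d$; each $\mu\in\mathcal{M}(\mathbb{R}^d)$ is identified with the functional $f\mapsto\int f\,d\mu$ in $(\mathcal{C}^{1+\alpha}(\mathbb{R}^d))^*$. $Z:=\overline{\mathcal{M}(\mathbb{R}^d)}^{(\mathcal{C}^{1+\alpha}(\mathbb{R}^d))^*}$ is the closure in the dual norm, equipped with the dual norm. $\delta_x$ is the Dirac measure concentrated at $x$, and span denotes the real linear span. *)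

(* Defs.v *)
From HB Require Import structures.
From mathcomp Require Import all_boot all_order all_algebra.
From mathcomp Require Import all_classical all_reals all_analysis.
From mathcomp Require Import measurable_realfun.
From mathcomp Require Import ring lra.

Set Implicit Arguments.
Unset Strict Implicit.
Unset Printing Implicit Defensive.

Import Order.TTheory GRing.Theory Num.Theory.
Import numFieldNormedType.Exports.

Local Open Scope classical_set_scope.
Local Open Scope ring_scope.

Section sup_lemmas.
Context {R : realType} {I : Type}.
Implicit Types (D : set I) (F G : I -> R).

Lemma sup_image_ub D F i : has_ubound (F @` D) -> D i -> F i <= sup (F @` D).
Proof. by move=> hF Di; apply: ub_le_sup => //; exists i. Qed.

Lemma sup_image_le D F M : 0 <= M -> (forall i, D i -> F i <= M) ->
  sup (F @` D) <= M.
Proof.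
move=> M0 FM; have [->|D0] := eqVneq D set0; first by rewrite image_set0 sup0.
apply: ge_sup; first by have /set0P[i Di] := D0; exists (F i), i.
by move=> _ [i Di <-]; exact: FM.
Qed.

Lemma sup_image_ge0 D F : has_ubound (F @` D) -> (forall i, 0 <= F i) ->
  0 <= sup (F @` D).
Proof.
move=> hF F0; have [->|D0] := eqVneq D set0; first by rewrite image_set0 sup0.
have /set0P[i Di] := D0; exact: le_trans (F0 i) (sup_image_ub hF Di).
Qed.

Lemma sup_image_lin (a : R) D F G (H : I -> R) : (forall i, 0 <= F i) ->
  (forall i, 0 <= G i) -> (forall i, D i -> H i <= `|a| * F i + G i) ->
  has_ubound (F @` D) -> has_ubound (G @` D) ->
  has_ubound (H @` D) /\
  sup (H @` D) <= `|a| * sup (F @` D) + sup (G @` D).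
Proof.
move=> F0 G0 HFG hF hG.
have M i : D i -> H i <= `|a| * sup (F @` D) + sup (G @` D).
  move=> Di; rewrite (le_trans (HFG i Di))// lerD ?sup_image_ub//.
  by rewrite ler_wpM2l// sup_image_ub.
split; first by exists (`|a| * sup (F @` D) + sup (G @` D)) => _ [i Di <-]; exact: M.
by apply: sup_image_le => //; rewrite addr_ge0 ?mulr_ge0 ?sup_image_ge0.
Qed.

End sup_lemmas.

Section euclidean_norm.
Context {R : realType} {d : nat}.
Implicit Types v w : 'rV[R]_d.

(* The library norm on matrices is the maximum norm. *)
Definition enorm v : R := Num.sqrt (\sum_(i < d) v 0 i ^+ 2).

Let ssq_ge0 v : 0 <= \sum_(i < d) v 0 i ^+ 2.
Proof. by apply: sumr_ge0 => i _; exact: sqr_ge0. Qed.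

Lemma enorm_ge0 v : 0 <= enorm v. Proof. exact: sqrtr_ge0. Qed.

Lemma sqr_enorm v : enorm v ^+ 2 = \sum_(i < d) v 0 i ^+ 2.
Proof. by rewrite sqr_sqrtr. Qed.

Lemma enorm_eq0 v : enorm v = 0 -> v = 0.
Proof.
move=> v0; apply/rowP => i; rewrite mxE; apply/eqP; rewrite -sqrf_eq0.
have /eqP := sqr_enorm v; rewrite v0 expr0n/= eq_sym.
by rewrite psumr_eq0 ?[_ == 0]/= => [/allP/(_ i (mem_index_enum _))//|j _];
  rewrite ?sqr_ge0.
Qed.

Lemma enorm0 : enorm 0 = 0.
Proof.
by rewrite /enorm big1 ?sqrtr0// => i _; rewrite mxE expr0n.
Qed.

Lemma enormZ (l : R) v : enorm (l *: v) = `|l| * enorm v.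
Proof.
rewrite /enorm -sqrtr_sqr -sqrtrM ?sqr_ge0// mulr_sumr.
by congr Num.sqrt; apply: eq_bigr => i _; rewrite mxE exprMn.
Qed.

Lemma enormD v w : enorm (v + w) <= enorm v + enorm w.
Proof.
have [/enorm_eq0 ->|v0] := eqVneq (enorm v) 0; first by rewrite enorm0 !add0r.
have [/enorm_eq0 ->|w0] := eqVneq (enorm w) 0; first by rewrite enorm0 !addr0.
have vw : 0 < enorm v * enorm w by rewrite mulr_gt0// lt_def enorm_ge0 ?v0 ?w0.
have CS : \sum_(i < d) v 0 i * w 0 i <= enorm v * enorm w.
  rewrite -(ler_pM2l vw) -(ler_pM2l (ltr0Sn R 1)).
  apply: (@le_trans _ _ (\sum_(i < d) (enorm w ^+ 2 * v 0 i ^+ 2 +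
                                       enorm v ^+ 2 * w 0 i ^+ 2))).
    rewrite !mulr_sumr; apply: ler_sum => i _; rewrite -subr_ge0.
    set a := enorm v; set b := enorm w.
    suff -> : b ^+ 2 * v 0 i ^+ 2 + a ^+ 2 * w 0 i ^+ 2 -
      2%:R * (a * b * (v 0 i * w 0 i)) = (b * v 0 i - a * w 0 i) ^+ 2.
      exact: sqr_ge0.
    ring.
  rewrite big_split/= -!mulr_sumr -!sqr_enorm.
  by rewrite le_eqVlt; apply/orP; left; apply/eqP; ring.
rewrite -(ler_pXn2r (ltn0Sn 1)) ?nnegrE ?addr_ge0 ?enorm_ge0//.
rewrite sqrrD !sqr_enorm.
under eq_bigr do rewrite mxE sqrrD.
rewrite !big_split/= lerD2r lerD2l.
by rewrite -mulr2n lerMn2r CS.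
Qed.

End euclidean_norm.

Lemma continuous_lin {R : realType} {V W : normedModType R} (a : R)
    (F G : V -> W) :
  continuous F -> continuous G -> continuous (fun x => a *: F x + G x).
Proof.
by move=> cF cG x; apply: cvgD; [apply: cvgZl_tmp; exact: cF|exact: cG].
Qed.

Lemma add3_lin {R : realType} (c x1 x2 x3 y1 y2 y3 z1 z2 z3 : R) :
  z1 <= c * x1 + y1 -> z2 <= c * x2 + y2 -> z3 <= c * x3 + y3 ->
  z1 + z2 + z3 <= c * (x1 + x2 + x3) + (y1 + y2 + y3).
Proof. lra. Qed.

Section holder_functions.
Context {R : realType} {d : nat}.
Implicit Types (f g : 'rV[R]_d -> R) (x : 'rV[R]_d).

Definition grad f x : 'rV[R]_d := \row_(i < d) 'D_(delta_mx 0 i) f x.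

Definition C1 f := (forall x, differentiable f x) /\ continuous (grad f).

(* The sets whose suprema make up the norm of C^{1+alpha}; an unbounded set
   has sup 0 in the library, hence the separate finiteness conditions. *)
Definition values f : set R := [set `|f x| | x in setT].

Definition grad_values f : set R := [set enorm (grad f x) | x in setT].

Definition grad_quotients (alpha : R) f : set R :=
  [set enorm (grad f p.1 - grad f p.2) / (enorm (p.1 - p.2) `^ alpha)
  | p in [set p : 'rV[R]_d * 'rV[R]_d | p.1 != p.2]].

Definition finite_holder_norm alpha f :=
  [/\ has_ubound (values f), has_ubound (grad_values f) &
      has_ubound (grad_quotients alpha f)].

Definition holder_norm alpha f : R :=
  sup (values f) + sup (grad_values f) + sup (grad_quotients alpha f).

Definition holder_pred (alpha : R) : {pred 'rV[R]_d -> R} :=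
  [pred f | `[< C1 f /\ finite_holder_norm alpha f >]].

Lemma gradD f g x : differentiable f x -> differentiable g x ->
  grad (f + g) x = grad f x + grad g x.
Proof.
move=> df dg; apply/rowP => i; rewrite !mxE.
by rewrite deriveD//; exact: diff_derivable.
Qed.

Lemma gradZ (l : R) f x : differentiable f x ->
  grad (l *: f) x = l *: grad f x.
Proof.
move=> df; apply/rowP => i; rewrite !mxE.
by rewrite deriveZ//; exact: diff_derivable.
Qed.


Let quot (alpha : R) f (p : 'rV[R]_d * 'rV[R]_d) :=
  enorm (grad f p.1 - grad f p.2) / (enorm (p.1 - p.2) `^ alpha).

Let quot_ge0 alpha f p : 0 <= quot alpha f p.
Proof. by rewrite divr_ge0 ?enorm_ge0 ?powR_ge0. Qed.

Lemma C1_lin (a : R) f g : C1 f -> C1 g -> C1 (a *: f + g).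
Proof.
move=> [df cf] [dg cg]; split=> [x|].
  by apply: differentiableD => //; exact: differentiableZ.
have -> : grad (a *: f + g) = (fun x => a *: grad f x + grad g x).
  by apply/funext => x; rewrite gradD ?gradZ//; exact: differentiableZ.
exact: continuous_lin cf cg.
Qed.

Lemma holder_norm_lin (alpha a : R) f g : C1 f -> C1 g ->
  finite_holder_norm alpha f -> finite_holder_norm alpha g ->
  finite_holder_norm alpha (a *: f + g) /\
  holder_norm alpha (a *: f + g) <=
    `|a| * holder_norm alpha f + holder_norm alpha g.
Proof.
move=> [df _] [dg _] [f1 f2 f3] [g1 g2 g3].
have gradE x : grad (a *: f + g) x = a *: grad f x + grad g x.
  by rewrite gradD ?gradZ//; exact: differentiableZ.
have [h1 n1] : has_ubound (values (a *: f + g)) /\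
    sup (values (a *: f + g)) <= `|a| * sup (values f) + sup (values g).
  apply: (sup_image_lin _ _ _ f1 g1) => [x|x|x _]; rewrite ?normr_ge0//.
  by rewrite (le_trans (ler_normD _ _))// normrM.
have [h2 n2] : has_ubound (grad_values (a *: f + g)) /\
    sup (grad_values (a *: f + g)) <=
    `|a| * sup (grad_values f) + sup (grad_values g).
  apply: (sup_image_lin _ _ _ f2 g2) => [x|x|x _]; rewrite ?enorm_ge0//.
  by rewrite gradE (le_trans (enormD _ _))// enormZ.
have [h3 n3] : has_ubound (grad_quotients alpha (a *: f + g)) /\
    sup (grad_quotients alpha (a *: f + g)) <=
    `|a| * sup (grad_quotients alpha f) + sup (grad_quotients alpha g).
  apply: (sup_image_lin _ _ _ f3 g3) => [p|p|p _].
  - exact: quot_ge0.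
  - exact: quot_ge0.
  rewrite mulrA -mulrDl ler_wpM2r ?invr_ge0 ?powR_ge0// !gradE.
  rewrite -enormZ (le_trans _ (enormD _ _))//.
  by rewrite opprD addrACA -scalerBr.
by split; [split|exact: add3_lin n1 n2 n3].
Qed.

Lemma holder_norm_ge0 alpha f : finite_holder_norm alpha f ->
  0 <= holder_norm alpha f.
Proof.
by move=> [h1 h2 h3]; rewrite !addr_ge0// sup_image_ge0// => x;
  rewrite ?enorm_ge0// quot_ge0.
Qed.

Lemma normr_le_holder_norm alpha f x : finite_holder_norm alpha f ->
  `|f x| <= holder_norm alpha f.
Proof.
move=> [h1 h2 h3]; rewrite /holder_norm -addrA.
rewrite (le_trans (sup_image_ub h1 I : `|f x| <= _))// lerDl addr_ge0//.
  by rewrite sup_image_ge0// => y; rewrite enorm_ge0.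
by rewrite sup_image_ge0// => p; rewrite quot_ge0.
Qed.

Lemma grad0 x : grad 0 x = 0.
Proof. by apply/rowP => i; rewrite !mxE derive_cst. Qed.

Lemma C1_0 : C1 0.
Proof.
split=> [x|]; first exact: differentiable_cst.
have -> : grad 0 = cst 0 by apply/funext => x; rewrite grad0.
exact: cst_continuous.
Qed.

Lemma finite_holder_norm0 alpha : finite_holder_norm alpha 0.
Proof.
split; exists 0 => _ [x _ <-]; first by rewrite normr0.
  by rewrite grad0 enorm0.
by rewrite !grad0 subr0 enorm0 mul0r.
Qed.

Lemma holder_norm0 alpha : holder_norm alpha 0 = 0.
Proof.
apply/eqP; rewrite eq_le holder_norm_ge0 ?andbT; last exact: finite_holder_norm0.
have n1 : sup (values 0) <= 0.
  by apply: sup_image_le => // x _; rewrite normr0.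
have n2 : sup (grad_values 0) <= 0.
  by apply: sup_image_le => // x _; rewrite grad0 enorm0.
have n3 : sup (grad_quotients alpha 0) <= 0.
  by apply: sup_image_le => // x _; rewrite !grad0 subr0 enorm0 mul0r.
by apply: (le_trans (lerD (lerD n1 n2) n3)); rewrite !addr0.
Qed.

Lemma holder_pred_submod_closed alpha : submod_closed (holder_pred alpha).
Proof.
split.
  by apply/asboolP; split; [exact: C1_0|exact: finite_holder_norm0].
move=> a f g /asboolP[f1 f2] /asboolP[g1 g2]; apply/asboolP; split.
  exact: C1_lin.
exact: (holder_norm_lin a f1 g1 f2 g2).1.
Qed.

HB.instance Definition _ alpha := GRing.isSubmodClosed.Build _ _
  (holder_pred alpha) (holder_pred_submod_closed alpha).

End holder_functions.

Section normalization.
Context {R : realType} {M : lmodType R} (N : M -> R).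

Lemma sublinear_homogeneous (l : R) x : N 0 = 0 ->
  (forall a x y, N (a *: x + y) <= `|a| * N x + N y) ->
  N (l *: x) = `|l| * N x.
Proof.
move=> N0 Nlin; have le a y : N (a *: y) <= `|a| * N y.
  by have := Nlin a y 0; rewrite addr0 N0 addr0.
have [->|l0] := eqVneq l 0; first by rewrite scale0r N0 normr0 mul0r.
apply/eqP; rewrite eq_le le/= -ler_pdivlMl ?normr_gt0// -normfV.
by rewrite -[x in N x <= _](scalerK l0) le.
Qed.

End normalization.

Record holder (R : realType) (d : nat) (alpha : R) := Holder {
  holder_fun :> 'rV[R]_d -> R;
  holder_funP : holder_fun \in holder_pred alpha }.

HB.instance Definition _ (R : realType) (d : nat) (alpha : R) :=
  [isSub for @holder_fun R d alpha].
HB.instance Definition _ (R : realType) (d : nat) (alpha : R) :=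
  [Choice of holder d alpha by <:].
HB.instance Definition _ (R : realType) (d : nat) (alpha : R) :=
  [SubChoice_isSubLmodule of holder d alpha by <:].

Section holder_normed_module.
Context {R : realType} {d : nat} {alpha : R}.
Local Notation V := (holder d alpha).
Implicit Types f g : V.

Lemma holder_C1 f : C1 f.
Proof. by case: f => f /= /asboolP[]. Qed.

Lemma holder_finite f : finite_holder_norm alpha f.
Proof. by case: f => f /= /asboolP[]. Qed.

Let N f := holder_norm alpha f.

Let N0 : N 0 = 0. Proof. exact: holder_norm0. Qed.

Let Nlin (a : R) f g : N (a *: f + g) <= `|a| * N f + N g.
Proof.
exact: (holder_norm_lin a (holder_C1 f) (holder_C1 g)
  (holder_finite f) (holder_finite g)).2.
Qed.

Let ler_ND f g : N (f + g) <= N f + N g.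
Proof. by have := Nlin 1 f g; rewrite scale1r normr1 mul1r. Qed.

Let NZ (l : R) f : N (l *: f) = `|l| * N f.
Proof. exact: sublinear_homogeneous. Qed.

Let N0_eq0 f : N f = 0 -> f = 0.
Proof.
move=> f0; apply/val_inj/funext => x /=; apply/eqP.
by rewrite -normr_le0 -f0; exact/normr_le_holder_norm/holder_finite.
Qed.

HB.instance Definition _ := Lmodule_isNormed.Build R V ler_ND NZ N0_eq0.

Lemma holder_normE f : `|f| = holder_norm alpha f.
Proof. by []. Qed.

End holder_normed_module.

Section dual_predicate.
Context {R : realType} {V : normedModType R}.
Implicit Types phi psi : V -> R.

Definition dual_pred : {pred V -> R} :=
  [pred phi : V -> R | `[< linear phi /\ continuous phi >]].

Definition unit_ball_values phi : set R :=
  [set `|phi x| | x in [set x : V | `|x| <= 1]].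

Lemma dual_pred_submod_closed : submod_closed dual_pred.
Proof.
split.
  apply/asboolP; split; last by move=> x; exact: cvg_cst.
  by move=> a x y; rewrite scaler0 addr0.
move=> a f g /asboolP[lf cf] /asboolP[lg cg]; apply/asboolP; split.
  move=> k x y; have fE : f (k *: x + y) = k * f x + f y := lf k x y.
  have gE : g (k *: x + y) = k * g x + g y := lg k x y.
  change (a * f (k *: x + y) + g (k *: x + y) =
    k * (a * f x + g x) + (a * f y + g y)).
  by rewrite fE gE; ring.
exact: (continuous_lin (V := V) (W := R^o) cf cg).
Qed.

HB.instance Definition _ := GRing.isSubmodClosed.Build _ _
  dual_pred dual_pred_submod_closed.

Lemma dual_bounded phi : linear phi -> continuous phi ->
  exists2 M : R, 0 <= M & forall x, `|phi x| <= M * `|x|.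
Proof.
move=> lphi cphi.
pose phi' : {linear V -> R^o} := HB.pack (phi : V -> R^o)
  (GRing.isLinear.Build R V R^o *:%R phi lphi).
have /linear_boundedP : bounded_near phi' (nbhs (0 : V)).
  by apply: continuous_linear_bounded; exact: cphi.
move=> /pinfty_ex_gt0[M M0 phiM]; exists M => //; exact: ltW.
Qed.

End dual_predicate.

Record dual (R : realType) (V : normedModType R) := Dual {
  dual_fun :> V -> R;
  dual_funP : dual_fun \in dual_pred }.

HB.instance Definition _ (R : realType) (V : normedModType R) :=
  [isSub for @dual_fun R V].
HB.instance Definition _ (R : realType) (V : normedModType R) :=
  [Choice of dual V by <:].
HB.instance Definition _ (R : realType) (V : normedModType R) :=
  [SubChoice_isSubLmodule of dual V by <:].

Section dual_normed_module.
Context {R : realType} {V : normedModType R}.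
Implicit Types phi psi : dual V.

Lemma dual_linear phi : linear phi.
Proof. by case: phi => phi /= /asboolP[]. Qed.

Lemma dual_continuous phi : continuous phi.
Proof. by case: phi => phi /= /asboolP[]. Qed.

Definition dual_norm phi : R := sup (unit_ball_values phi).

Lemma has_ubound_dual phi : has_ubound (unit_ball_values phi).
Proof.
have [M M0 phiM] := dual_bounded (dual_linear phi) (@dual_continuous phi).
exists M => _ [x /= x1 <-]; rewrite (le_trans (phiM x))//.
by rewrite -[leRHS]mulr1 ler_wpM2l.
Qed.

Lemma dualZ phi (a : R) x : phi (a *: x) = a * phi x.
Proof.
have phi0 : phi 0 = 0.
  by have := dual_linear phi (-1) 0 0; rewrite scaler0 addr0 /GRing.scale/=
    mulN1r addNr.
by have := dual_linear phi a x 0; rewrite !addr0 phi0 addr0.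
Qed.

Lemma le_dual_norm phi x : `|phi x| <= dual_norm phi * `|x|.
Proof.
have [->|x0] := eqVneq x 0.
  by rewrite -(scale0r 0) dualZ mul0r !normr0 scale0r normr0 mulr0.
rewrite -ler_pdivrMr ?normr_gt0//.
have -> : `|phi x| / `|x| = `|phi (`|x|^-1 *: x)|.
  by rewrite dualZ normrM normfV normr_id mulrC.
apply: (sup_image_ub (has_ubound_dual phi)) => /=.
by rewrite normrZ normfV normr_id mulVf// normr_eq0.
Qed.

Let N0 : dual_norm 0 = 0.
Proof.
apply/eqP; rewrite eq_le; apply/andP; split.
  by apply: sup_image_le => // x _; rewrite normr0.
by apply: (sup_image_ge0 (has_ubound_dual 0)) => x; rewrite normr_ge0.
Qed.

Let Nlin (a : R) phi psi :
  dual_norm (a *: phi + psi) <= `|a| * dual_norm phi + dual_norm psi.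
Proof.
apply: (sup_image_lin _ _ _ (has_ubound_dual phi) (has_ubound_dual psi)).2
  => [x|x|x _]; rewrite ?normr_ge0//.
by rewrite (le_trans (ler_normD _ _))// normrM.
Qed.

Let ler_ND phi psi : dual_norm (phi + psi) <= dual_norm phi + dual_norm psi.
Proof. by have := Nlin 1 phi psi; rewrite scale1r normr1 mul1r. Qed.

Let NZ (l : R) phi : dual_norm (l *: phi) = `|l| * dual_norm phi.
Proof. exact: sublinear_homogeneous. Qed.

Let N0_eq0 phi : dual_norm phi = 0 -> phi = 0.
Proof.
move=> phi0; apply/val_inj/funext => x /=; apply/eqP.
by rewrite -normr_le0 (le_trans (le_dual_norm phi x))// phi0 mul0r.
Qed.

HB.instance Definition _ := Lmodule_isNormed.Build R (dual V) ler_ND NZ N0_eq0.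

Lemma dual_normE phi : `|phi| = sup (unit_ball_values phi).
Proof. by []. Qed.

End dual_normed_module.

Section charge_integral.
Context d (T : measurableType d) (R : realType).
Implicit Types (mu : {charge set T -> \bar R}) (f : T -> R).

Definition hahn_pos mu : set T := projT1 (cid (Hahn_decomposition mu)).

Definition hahn_neg mu : set T :=
  projT1 (cid (projT2 (cid (Hahn_decomposition mu)))).

Lemma hahnP mu : hahn_decomposition mu (hahn_pos mu) (hahn_neg mu).
Proof. exact: projT2 (cid (projT2 (cid (Hahn_decomposition mu)))). Qed.

Definition charge_integral mu f : R :=
  \int[jordan_pos (hahnP mu)]_x f x - \int[jordan_neg (hahnP mu)]_x f x.

End charge_integral.

Notation borel_rV R d := (g_sigma_algebraType (@open 'rV[R]_d)).

Section radon_measures.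
Context {R : realType} {d : nat}.
Local Notation T := (borel_rV R d).
Implicit Type mu : {charge set T -> \bar R}.

(* Charges are finite by definition, so only inner regularity of the total
   variation remains to be required. *)
Definition radon mu := forall A : set T, measurable A ->
  charge_variation (hahnP mu) A =
  ereal_sup [set charge_variation (hahnP mu) K
            | K in [set K : set T | compact (K : set 'rV[R]_d) /\ K `<=` A]].

Lemma continuous_measurable_rV (f : 'rV[R]_d -> R) :
  continuous f -> measurable_fun [set: T] (f : T -> R).
Proof.
move=> /continuousP cf; apply: (measurability _ (RGenOpens.measurableE R)).
move=> _ [_ [a [b ->] <-]]; rewrite setTI; apply: sub_sigma_algebra.
exact/cf/interval_open.
Qed.

Context {alpha : R}.
Implicit Type f : holder d alpha.

Lemma holder_bounded f x : `|f x| <= `|f|.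
Proof. exact/normr_le_holder_norm/holder_finite. Qed.

Lemma holder_integrable (m : {finite_measure set T -> \bar R}) f :
  m.-integrable [set: T] (EFin \o (f : T -> R)).
Proof.
apply: measurable_bounded_integrable => //.
- exact: fin_num_fun_lty.
- apply: continuous_measurable_rV => x.
  by apply: differentiable_continuous; exact: (holder_C1 f).1.
- exists `|f|; split; first exact: normr_real.
  by move=> M /ltW fM x _; exact: le_trans (holder_bounded f x) fM.
Qed.

Let integral_lin (m : {finite_measure set T -> \bar R}) (a : R) f g :
  \int[m]_x (a *: f + g) x = a * (\int[m]_x f x) + \int[m]_x g x.
Proof.
rewrite -RintegralZl//; last exact: holder_integrable.
rewrite -RintegralD//; last exact: holder_integrable.
exact: (holder_integrable m (a *: f)).
Qed.

Let integral_le (m : {finite_measure set T -> \bar R}) f :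
  `|\int[m]_x f x| <= fine (m [set: T]) * `|f|.
Proof.
have fint := holder_integrable m f.
rewrite (le_trans (le_normr_Rintegral _ fint))//.
rewrite mulrC -Rintegral_cst//; apply: le_Rintegral => //.
- exact: (integrable_norm fint).
- apply: measurable_bounded_integrable => //; first exact: fin_num_fun_lty.
  by exists `|f|; split => [|M /ltW fM x _]; rewrite ?normr_real// normr_id.
- by move=> x _; exact: holder_bounded.
Qed.

Lemma charge_integral_dual mu :
  (fun f : holder d alpha => charge_integral mu f) \in dual_pred.
Proof.
have lin : linear (fun f : holder d alpha => charge_integral mu f).
  move=> a f g; rewrite /charge_integral !integral_lin /GRing.scale/=; ring.
apply/asboolP; split => // f0.
pose M := fine (jordan_pos (hahnP mu) [set: T]) +
          fine (jordan_neg (hahnP mu) [set: T]).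
have M0 : 0 <= M by rewrite addr_ge0 ?fine_ge0.
have bnd f : `|charge_integral mu f| <= M * `|f|.
  rewrite (le_trans (ler_normB _ _))// mulrDl lerD//; exact: integral_le.
pose phi : {linear holder d alpha -> R^o} :=
  HB.pack ((fun f => charge_integral mu f) : holder d alpha -> R^o)
  (GRing.isLinear.Build R (holder d alpha) R^o *:%R _ lin).
suff : continuous phi by exact.
apply: bounded_linear_continuous; apply/linear_boundedP.
near=> r => f; rewrite (le_trans (bnd f))// ler_wpM2r//.
Unshelve. all: by end_near. Qed.

Definition measure_functional mu : dual (holder d alpha) :=
  Dual (charge_integral_dual mu).

End radon_measures.

Section closure_of_measures.
Variables (R : realType) (d : nat) (alpha : R).
Local Notation dualC := (dual (holder d alpha)).

(* As a type, this set carries the topology induced by the dual norm. *)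
Definition Zspace : set dualC :=
  closure (measure_functional @` [set mu | radon mu]).

Definition delta (x : 'rV[R]_d) : dualC :=
  measure_functional (charge_of_finite_measure (\d_(x : borel_rV R d))).

End closure_of_measures.

Arguments Zspace {R} d alpha _.
Arguments delta {R d} alpha x.

Definition rational_points (R : realType) (d : nat) : set 'rV[R]_d :=
  range (map_mx (@ratr R) : 'rV[rat]_d -> 'rV[R]_d).

Arguments rational_points : clear implicits.

Definition linear_span (R : pzRingType) (V : lmodType R) (A : set V) : set V :=
  [set v | exists (n : nat) (c : 'I_n -> R) (a : 'I_n -> V),
    (forall i, A (a i)) /\ v = \sum_(i < n) c i *: a i].

Definition separable (T : topologicalType) :=
  exists2 D : set T, countable D & dense D.

(* Main.v *)
(* Functions of C^{1+alpha} are bounded by their norm and, by the mean value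
   theorem, Lipschitz with constant d times their norm. Hence, for a finite
   positive measure m, moving the mass of disjoint small pieces D_k of balls
   around finitely many rational points q_k to these points, and forgetting
   the little mass left outside, changes the functional by at most e in the
   dual norm. Signed measures follow by the Jordan decomposition; conversely
   a combination of Dirac measures is a Radon measure, being carried by a
   finite set. Rational coefficients then give a countable dense set. *)
Require Import Defs.
From mathcomp Require Import all_boot all_order all_algebra.
From mathcomp Require Import all_classical all_reals all_analysis.
From mathcomp Require Import measurable_realfun ring lra.

Import Order.TTheory GRing.Theory Num.Theory.
Import numFieldNormedType.Exports.

Local Open Scope classical_set_scope.
Local Open Scope ring_scope.

(** * Linearity of integration against a charge *)

Section charge_integral.
Context {d} {T : measurableType d} {R : realType}.
Implicit Types (m : {measure set T -> \bar R}) (nu : {charge set T -> \bar R}).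
Implicit Types (f : T -> R).

Definition charge_integrable nu f :=
  (jordan_pos (hahnP nu)).-integrable setT (EFin \o f) /\
  (jordan_neg (hahnP nu)).-integrable setT (EFin \o f).

Lemma integrable_measure_add m1 m2 f :
  m1.-integrable setT (EFin \o f) -> m2.-integrable setT (EFin \o f) ->
  (measure_add m1 m2).-integrable setT (EFin \o f).
Proof.
move=> /integrableP[mf f1] /integrableP[_ f2]; apply/integrableP; split => //.
rewrite ge0_integral_measure_add//; first exact: lte_add_pinfty.
exact: measurableT_comp.
Qed.

Lemma Rintegral_measure_add m1 m2 f :
  m1.-integrable setT (EFin \o f) -> m2.-integrable setT (EFin \o f) ->
  \int[measure_add m1 m2]_x f x = \int[m1]_x f x + \int[m2]_x f x.
Proof.
move=> f1 f2; rewrite /Rintegral integral_measure_add// fineD//.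
- exact: integrable_fin_num.
- exact: integrable_fin_num.
Qed.

(** The integral does not depend on how [nu] is written as a difference of measures, so the
    arbitrary Hahn decomposition in its definition can be replaced by a convenient pair. The
    hypothesis is additive because [m1] and [m2] may take infinite values. *)
Lemma charge_integral_sub nu m1 m2 f :
  (forall A, measurable A -> nu A + m2 A = m1 A)%E ->
  charge_integrable nu f ->
  m1.-integrable setT (EFin \o f) -> m2.-integrable setT (EFin \o f) ->
  charge_integral nu f = \int[m1]_x f x - \int[m2]_x f x.
Proof.
move=> nuE [fp fn] f1 f2; rewrite /charge_integral.
(* With p and n the Jordan parts of [nu], p + m2 = n + m1 as measures, since the finite value n(A)
   can be cancelled. *)
have : \int[measure_add (jordan_pos (hahnP nu)) m2]_x f x =
       \int[measure_add (jordan_neg (hahnP nu)) m1]_x f x.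
  congr fine; apply: eq_measure_integral => A mA _.
  apply: etrans (measure_addE _ _ A) _.
  apply/esym/(etrans (measure_addE _ _ A)).
  rewrite -nuE// (jordan_decomp (hahnP nu) mA).
  rewrite /cadd/= cscaleN1 addeA; congr (_ + _)%E.
  by rewrite addeC subeK// fin_num_measure.
rewrite !Rintegral_measure_add// => /eqP; rewrite -subr_eq => /eqP <-.
ring.
Qed.

Lemma Rintegral_mscale m (k : {nonneg R}) f :
  m.-integrable setT (EFin \o f) ->
  \int[mscale k m]_x f x = k%:num * \int[m]_x f x.
Proof.
move=> fi; have mf := measurable_int _ fi; rewrite /Rintegral.
rewrite integralE (integralE m).
rewrite (ge0_integral_mscale _ _ k (measurable_funepos mf))//.
rewrite (ge0_integral_mscale _ _ k (measurable_funeneg mf))//.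
have fp := integrable_pos_fin_num measurableT fi.
have fn := integrable_neg_fin_num measurableT fi.
rewrite -muleBr ?fin_num_adde_defl// ?fin_numN// fineM//.
by rewrite fin_numD fp fin_numN.
Qed.

(** The Jordan parts of a sum need not be the sums of the Jordan parts, but these sums still have
    the right difference. *)
Lemma charge_integral_cadd nu1 nu2 f :
  charge_integrable nu1 f -> charge_integrable nu2 f ->
  charge_integrable (cadd nu1 nu2) f ->
  charge_integral (cadd nu1 nu2) f =
  charge_integral nu1 f + charge_integral nu2 f.
Proof.
move=> [p1 n1] [p2 n2] f12.
rewrite (@charge_integral_sub _
  (measure_add (jordan_pos (hahnP nu1)) (jordan_pos (hahnP nu2)))
  (measure_add (jordan_neg (hahnP nu1)) (jordan_neg (hahnP nu2)))).
- by rewrite !Rintegral_measure_add// /charge_integral opprD addrACA.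
- move=> A mA; apply/esym/(etrans (measure_addE _ _ A))/esym.
  apply: etrans (congr1 (fun x => _ + x)%E (measure_addE _ _ A)) _.
  rewrite [X in (X + _)%E](_ : _ = nu1 A + nu2 A)%E//.
  rewrite (jordan_decomp (hahnP nu1) mA) (jordan_decomp (hahnP nu2) mA).
  rewrite /cadd/= !cscaleN1 addeACA.
  by congr (_ + _)%E; rewrite subeK// fin_num_measure.
- exact: f12.
- exact: integrable_measure_add.
- exact: integrable_measure_add.
Qed.

Lemma integrable_mscale m (k : {nonneg R}) f :
  m.-integrable setT (EFin \o f) -> (mscale k m).-integrable setT (EFin \o f).
Proof.
move=> /integrableP[mf lty]; apply/integrableP; split => //.
rewrite ge0_integral_mscale//; last exact: measurableT_comp.
by rewrite lte_mul_pinfty.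
Qed.

Lemma charge_integral_cscale (c : R) nu f :
  charge_integrable nu f -> charge_integrable (cscale c nu) f ->
  charge_integral (cscale c nu) f = c * charge_integral nu f.
Proof.
move=> [fp fn] fc.
pose p := jordan_pos (hahnP nu); pose n := jordan_neg (hahnP nu).
have pfin A : measurable A -> p A \is a fin_num by exact: fin_num_measure.
have nfin A : measurable A -> n A \is a fin_num by exact: fin_num_measure.
have nuE A : measurable A -> cscale c nu A = (c%:E * p A - c%:E * n A)%E.
  move=> mA; rewrite /cscale (jordan_decomp (hahnP nu) mA) /cadd/= cscaleN1.
  by rewrite muleBr// fin_num_adde_defl// fin_numN nfin.
have [c0|/ltW c0] := leP 0 c.
  rewrite (@charge_integral_sub _ (mscale (NngNum c0) p)
    (mscale (NngNum c0) n)).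
  - by rewrite !Rintegral_mscale//= -mulrBr.
  - move=> A mA; apply: etrans (congr1 (fun x => x + _)%E (nuE A mA)) _.
    by rewrite subeK// fin_numM// nfin.
  - exact: fc.
  - exact: integrable_mscale.
  - exact: integrable_mscale.
(* A nonpositive scalar exchanges the roles of the two Jordan parts. *)
have Nc0 : 0 <= - c by rewrite oppr_ge0.
rewrite (@charge_integral_sub _ (mscale (NngNum Nc0) n)
  (mscale (NngNum Nc0) p)).
- by rewrite !Rintegral_mscale//= -mulrBr -mulrNN opprK opprB.
- move=> A mA; apply: etrans (congr1 (fun x => x + _)%E (nuE A mA)) _.
  change (c%:E * p A - c%:E * n A + (- c)%:E * p A = (- c)%:E * n A)%E.
  rewrite EFinN !mulNe addeAC subee ?add0e//.
  by rewrite fin_numM// pfin.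
- exact: fc.
- exact: integrable_mscale.
- exact: integrable_mscale.
Qed.

Lemma charge_integral_finite_measure (m : {finite_measure set T -> \bar R}) f :
  charge_integrable (charge_of_finite_measure m) f ->
  m.-integrable setT (EFin \o f) ->
  charge_integral (charge_of_finite_measure m) f = \int[m]_x f x.
Proof.
move=> fi fm; rewrite (@charge_integral_sub _ m mzero f).
- by rewrite /Rintegral integral_measure_zero subr0.
- by move=> A mA; rewrite /mzero adde0.
- exact: fi.
- exact: fm.
- apply/integrableP; split; first exact: measurable_int fm.
  by rewrite integral_measure_zero.
Qed.

End charge_integral.

(** * Lipschitz estimate from the mean value theorem *)

Section real_analysis.
Context {R : realType} {d : nat}.
Implicit Types (f : 'rV[R]_d -> R) (x y v : 'rV[R]_d).

Lemma is_derive_line f x v (t : R) : differentiable f (x + t *: v) ->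
  is_derive t 1 (fun s : R => f (x + s *: v)) ('D_v f (x + t *: v)).
Proof.
move=> df.
have E : (fun h : R => h^-1 *: (f (x + (h *: 1 + t) *: v) - f (x + t *: v))) =
         (fun h : R => h^-1 *: (f (h *: v + (x + t *: v)) - f (x + t *: v))).
  apply/funext => h; congr (_ *: (f _ - _)).
  by rewrite [h *: 1]mulr1 scalerDl addrCA.
split.
  have := @diff_derivable _ _ _ f _ v df.
  by rewrite /derivable/= -E.
by rewrite /derive/= -E.
Qed.

(** Expand [v] in the standard basis: each of the d terms is a partial derivative, at most the
    Euclidean norm of the gradient, times a coordinate, at most the maximum norm [|v|]. *)
Lemma derive_le_grad f x v : differentiable f x ->
  `|'D_v f x| <= d%:R * enorm (grad f x) * `|v|.
Proof.
move=> df; have le1 i : `|'D_('e_i) f x| <= enorm (grad f x).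
  have -> : 'D_('e_i) f x = grad f x 0 i by rewrite mxE.
  rewrite -sqrtr_sqr ler_wsqrtr// (bigD1 i)//= lerDl sumr_ge0// => j _.
  exact: sqr_ge0.
have le2 i : `|v 0 i| <= `|v|.
  by rewrite [leRHS]mx_normrE (le_trans _ (le_bigmax _ _ (0, i))).
rewrite deriveE// {1}(row_sum_delta v) linear_sum/=.
rewrite (le_trans (ler_norm_sum _ _ _))//.
apply: (@le_trans _ _ (\sum_(i < d) enorm (grad f x) * `|v|)).
  apply: ler_sum => i _.
  by rewrite linearZ/= normrM mulrC ler_pM// -deriveE.
by rewrite sumr_const card_ord -mulrA mulr_natl.
Qed.

(** The mean value theorem on the segment from [y] to [x] reduces this to the supremum of the
    gradient, which is at most the full norm because the other two suprema are nonnegative. *)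
Lemma holder_lipschitz (alpha : R) (f : holder d alpha) x y :
  `|f x - f y| <= d%:R * `|f| * `|x - y|.
Proof.
pose v := x - y; pose g (s : R) := f (y + s *: v).
have dg (s : R) : is_derive s 1 g ('D_v f (y + s *: v)).
  by apply: is_derive_line; exact: (holder_C1 f).1.
have yv : y + v = x by rewrite addrC subrK.
have cg : {within `[0, 1], continuous g}.
  apply: continuous_subspaceT => s; apply: differentiable_continuous.
  by apply/derivable1_diffP; have [] := dg s.
have [c _] := MVT_segment ler01 (fun s _ => dg s) cg.
rewrite /g scale1r scale0r addr0 subr0 mulr1 yv => ->.
rewrite (le_trans (derive_le_grad _ _ _ _))//; first exact: (holder_C1 f).1.
rewrite ler_wpM2r// ler_wpM2l// holder_normE.
have [h1 h2 h3] := holder_finite f.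
rewrite (le_trans (sup_image_ub h2 I))// /holder_norm.
rewrite -addrA addrCA lerDl addr_ge0//.
  by apply: sup_image_ge0.
by apply: sup_image_ge0 => // p; rewrite divr_ge0 ?enorm_ge0 ?powR_ge0.
Qed.

End real_analysis.

(** * Combinations of Dirac measures as Radon measures *)

Section radon_functionals.
Context {R : realType} {d : nat} {alpha : R}.
Local Notation T := (borel_rV R d).
Local Notation dualC := (dual (holder d alpha)).
Implicit Types (nu : {charge set T -> \bar R}) (f : holder d alpha).

(** The supremum in inner regularity is attained at the finite, hence compact, set [A] intersected
    with [F]. *)
Lemma charge_radon_finite nu (F : set T) : finite_set F -> measurable F ->
  (forall A, measurable A -> nu A = nu (A `&` F)) -> radon nu.
Proof.
move=> finF mF nuF A mA; apply/eqP; rewrite eq_le; apply/andP; split.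
  have mAF : measurable (A `&` F) by exact: measurableI.
  have [mP mN] : measurable (hahn_pos nu) /\ measurable (hahn_neg nu).
    by have [[? _] [? _] _ _] := hahnP nu.
  have -> : charge_variation (hahnP nu) A =
      charge_variation (hahnP nu) (A `&` F).
    (* The Jordan parts are, up to sign, [nu] restricted to the Hahn sets, so they too ignore what
       lies outside [F]. *)
    have nuI B : measurable B -> nu (A `&` B) = nu (A `&` F `&` B).
      by move=> mB; rewrite setIAC; apply: nuF; exact: measurableI.
    rewrite /charge_variation/=; congr (_ + _)%E.
      rewrite !jordan_posE !cjordan_posE /crestr0 !mem_set// /crestr.
      exact: nuI.
    rewrite !jordan_negE !cjordan_negE /crestr0 !mem_set// /crestr.
    by rewrite nuI.
  apply: ereal_sup_ubound; exists (A `&` F) => //; split.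
    exact/finite_compact/finite_setIr.
  exact: subIsetl.
(* Conversely monotonicity suffices, once a compact [K] is known to be Borel: it is closed. *)
apply: ge_ereal_sup => _ [K [cK KA] <-].
apply: le_measure => //; rewrite ?inE//.
have : closed (K : set 'rV[R]_d) by apply: compact_closed.
rewrite -openC => oK; rewrite -(setCK K); apply: measurableC.
exact: sub_sigma_algebra.
Qed.

Lemma measurable_singleton (x : T) : measurable [set x].
Proof.
rewrite -(setCK [set x]); apply: measurableC; apply: sub_sigma_algebra.
rewrite /= openC; apply: (@accessible_closed_set1 'rV[R]_d).
exact/hausdorff_accessible/norm_hausdorff.
Qed.

Lemma holder_measurable f : measurable_fun [set: T] (EFin \o (f : T -> R)).
(* The Dirac measure at 0 only serves as some finite measure, integrability containing
   measurability. *)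
Proof. exact: measurable_int (holder_integrable (\d_(0 : T)) f). Qed.

Lemma Rintegral_dirac (x : T) f : \int[\d_x]_y f y = f x.
Proof.
rewrite /Rintegral integral_dirac//; last exact: holder_measurable.
by rewrite diracE in_setT mul1e.
Qed.

Lemma holder_charge_integrable f nu :
  charge_integrable nu (f : T -> R).
Proof. by split; exact: holder_integrable. Qed.

Lemma measure_functional_cadd nu1 nu2 :
  measure_functional (cadd nu1 nu2) =
  measure_functional nu1 + measure_functional nu2 :> dualC.
Proof.
apply/val_inj/funext => f /=.
by apply: charge_integral_cadd; exact: holder_charge_integrable.
Qed.

Lemma measure_functional_cscale (c : R) nu :
  measure_functional (cscale c nu) = c *: measure_functional nu :> dualC.
Proof.
apply/val_inj/funext => f /=.
by apply: charge_integral_cscale; exact: holder_charge_integrable.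
Qed.

Lemma deltaE x f : delta alpha x f = f x.
Proof.
rewrite /delta/= charge_integral_finite_measure.
- exact: Rintegral_dirac.
- exact: holder_charge_integrable.
- exact: holder_integrable.
Qed.

Lemma linear_span_delta_radon (A : set 'rV[R]_d) :
  linear_span (delta alpha @` A) `<=` measure_functional @` [set mu | radon mu].
Proof.
move=> _ [n [c [a [aA ->]]]].
have /choice[x xa] : forall i, exists x, delta alpha x = a i.
  by move=> i; have [x _ <-] := aA i; exists x.
(* The Radon property is not carried through the induction; being carried by a finite set is, and it
   passes to sums by taking unions. *)
suff [nu [F [finF mF nuF ->]]] : exists nu (F : set T), [/\ finite_set F,
    measurable F, (forall A, measurable A -> nu A = nu (A `&` F)) &
    \sum_(i < n) c i *: a i = measure_functional nu].
  by exists nu => //; exact: charge_radon_finite finF mF nuF.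
elim: n c a aA x xa => [|n ih] c a aA x xa.
  pose nu0 : {charge set T -> \bar R} :=
    cscale 0 (charge_of_finite_measure (\d_(0 : T))).
  exists nu0, set0; split => //.
    by move=> B _; rewrite setI0 charge0; exact: mul0e.
  by rewrite big_ord0 measure_functional_cscale scale0r.
have [|i|nu [F [finF mF nuF nuE]]] :=
  ih (c \o lift ord0) (a \o lift ord0) _ (x \o lift ord0).
- by move=> i; exact: aA.
- exact: xa.
pose dx : {charge set T -> \bar R} :=
  charge_of_finite_measure (\d_(x ord0 : T)).
exists (cadd (cscale (c ord0) dx) nu), (F `|` [set (x ord0 : T)]); split.
- by rewrite finite_setU; split => //; exact: finite_set1.
- by apply: measurableU => //; exact: measurable_singleton.
- move=> B mB; rewrite /cadd/= /cscale/=.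
  have mBF : measurable (B `&` (F `|` [set (x ord0 : T)])).
    apply: measurableI => //; apply: measurableU => //.
    exact: measurable_singleton.
  congr (_ + _)%E.
    congr (_ * _)%E; rewrite /dx/= /charge_of_finite_measure !diracE.
    congr (_%:R%:E); congr nat_of_bool; apply/idP/idP; rewrite !inE.
      by move=> ?; split => //; right.
    by case.
  (* Adding a point to [F] changes nothing for [nu], since both sides reduce to [B] intersected with
     [F]. *)
  by rewrite nuF// [RHS]nuF// -setIA setUK.
rewrite big_ord_recl measure_functional_cadd measure_functional_cscale -xa.
by congr (_ + _); exact: nuE.
Qed.

End radon_functionals.

(** * Approximation by rational points and by constants *)

Section approximation.
Context {R : realType}.

Lemma ratr_approx (x e : R) : 0 < e -> exists q, `|x - ratr q| < e.
Proof.
move=> e0; have [|q] := @rat_in_itvoo R (x - e) (x + e).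
  by rewrite ltrD2l gtrN.
rewrite in_itv/= => qx; exists q.
by rewrite distrC ltr_distl.
Qed.

(** Balls are those of the maximum norm, so the coordinates can be approximated separately with the
    same [e]. *)
Lemma rational_points_ball (d : nat) (x : 'rV[R]_d) (e : R) : 0 < e ->
  exists q : 'rV[rat]_d, ball (map_mx (@ratr R) q) e x.
Proof.
move=> e0; have /choice[q qx] := fun i => ratr_approx (x 0 i) _ e0.
exists (\row_i q i); split=> // k i.
rewrite !mxE ord1 /ball/= distrC; exact: qx.
Qed.

(** Used with [v] the value of [f] at a rational point near [E], to move the mass of [E] there, and
    with [v] = 0, to discard that mass. *)
Lemma Rintegral_near_cst {d'} {T : measurableType d'}
    (m : {finite_measure set T -> \bar R}) (E : set T) (f : T -> R) (v c : R) :
  measurable E -> m.-integrable setT (EFin \o f) ->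
  (forall x, E x -> `|f x - v| <= c) ->
  `|\int[m]_(x in E) f x - v * fine (m E)| <= c * fine (m E).
Proof.
move=> mE fi fv.
have fE : m.-integrable E (EFin \o f) by exact: integrableS fi.
have ci (r : R) : m.-integrable E (EFin \o cst r).
  by apply/finite_measure_integrable_cst.
rewrite -!Rintegral_cst// -RintegralB//; last exact: ci.
have fvi : m.-integrable E (EFin \o (fun x => f x - v)).
  exact: (integrableB mE fE (ci v)).
rewrite (le_trans (le_normr_Rintegral _ fvi))//.
by apply: le_Rintegral => //; [exact: (integrable_norm fvi)|exact: ci].
Qed.

End approximation.

(** * Linear spans, closures and rational coefficients *)

Section linear_span.
Context {R : realType} {V : normedModType R}.
Implicit Types (A : set V) (u v : V).

Lemma linear_spanD A u v :
  linear_span A u -> linear_span A v -> linear_span A (u + v).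
Proof.
move=> [m [b [x [Ax ->]]]] [n [c [y [Ay ->]]]].
exists (m + n)%N,
  (fun i : 'I_(m + n) =>
     match fintype.split i with inl j => b j | inr j => c j end),
  (fun i : 'I_(m + n) =>
     match fintype.split i with inl j => x j | inr j => y j end); split.
  by move=> i; case: fintype.split.
rewrite big_split_ord/=; congr (_ + _); apply: eq_bigr => i _.
  by rewrite (unsplitK (inl i)).
by rewrite (unsplitK (inr i)).
Qed.

Lemma linear_spanZ A (c : R) u : linear_span A u -> linear_span A (c *: u).
Proof.
move=> [m [b [x [Ax ->]]]]; exists m, (fun i => c * b i), x; split=> //.
by rewrite scaler_sumr; apply: eq_bigr => i _; rewrite scalerA.
Qed.

Lemma linear_span_sum A n (c : 'I_n -> R) (a : 'I_n -> V) :
  (forall i, A (a i)) -> linear_span A (\sum_(i < n) c i *: a i).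
Proof. by move=> Aa; exists n, c, a. Qed.

Lemma closure_normP A v :
  closure A v <-> forall e, 0 < e -> exists2 a, A a & `|v - a| < e.
Proof.
split=> [cA e e0|H B /nbhs_ballP[e /= e0 eB]].
  have [a [Aa va]] := cA _ (nbhsx_ballx v e e0); exists a => //.
  by move: va; rewrite -ball_normE.
have [a Aa va] := H e e0.
by exists a; split => //; apply: eB; rewrite -ball_normE.
Qed.

Lemma closure_rational_span n (c : 'I_n -> R) (a : 'I_n -> V) :
  closure [set \sum_(i < n) ratr (r i) *: a i | r in @setT ('I_n -> rat)]
    (\sum_(i < n) c i *: a i).
Proof.
apply/closure_normP => e e0.
have /choice[r rc] : forall i, exists r : rat,
    `|c i - ratr r| * `|a i| < e / n.+1%:R.
  (* Adding 1 keeps the denominator positive when [a i] vanishes; dividing by n + 1 instead of n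
     covers the empty sum and makes the total error strictly less than [e]. *)
  move=> i; pose h := e / n.+1%:R / (`|a i| + 1).
  have h0 : 0 < h by rewrite !divr_gt0// ltr_wpDl.
  have [r cr] := ratr_approx (c i) _ h0.
  exists r; rewrite (@le_lt_trans _ _ (h * `|a i|))//.
    by rewrite ler_wpM2r// ltW.
  rewrite /h -mulrA gtr_pMr ?divr_gt0// mulrC ltr_pdivrMr ?ltr_wpDl//.
  by rewrite mul1r ltrDl.
exists (\sum_(i < n) ratr (r i) *: a i); first by exists r.
rewrite -sumrB (le_lt_trans (ler_norm_sum _ _ _))//.
apply: (@le_lt_trans _ _ (\sum_(i < n) e / n.+1%:R)).
  by apply: ler_sum => i _; rewrite -scalerBl normrZ ltW.
rewrite sumr_const card_ord -[ltLHS]mulr_natr -mulrA gtr_pMr// mulrC.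
by rewrite ltr_pdivrMr// mul1r ltr_nat.
Qed.

End linear_span.

(** * Approximation of a finite positive measure *)

Section measures_approximation.
Context {R : realType} {d : nat} {alpha : R}.
Local Notation T := (borel_rV R d).
Local Notation dualC := (dual (holder d alpha)).
Implicit Types (f : holder d alpha).

(** An enumeration of the rational points; numbers that code no point are sent to the origin, which
    is rational too. *)
Let rat_point (k : nat) : 'rV[R]_d :=
  map_mx ratr (odflt (0 : 'rV[rat]_d) (unpickle k)).

Lemma open_measurable_rV (A : set T) : open (A : set 'rV[R]_d) -> measurable A.
Proof. by move=> oA; exact: sub_sigma_algebra. Qed.

(** As [phi] is chosen before [f], the estimate is one in the dual norm. *)
Lemma finite_measure_approx (m : {finite_measure set T -> \bar R}) (e : R) :
  0 < e -> exists2 phi : dualC,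
    linear_span (delta alpha @` rational_points R d) phi &
    forall f, `|\int[m]_x f x - phi f| <= e * `|f|.
Proof.
move=> e0; pose M := fine (m setT).
have M0 : 0 <= M by exact: fine_ge0.
(* Chosen so that d r M is at most e / 2; adding 1 allows [M] = 0. *)
pose r := e / 2 / (d%:R * M + 1).
have dM0 : 0 < d%:R * M + 1 by rewrite ltr_wpDl// mulr_ge0.
have r0 : 0 < r by rewrite !divr_gt0.
pose B k : set T := ball (rat_point k) r.
have mB k : measurable (B k).
  by apply: open_measurable_rV; exact: ball_open.
pose D := seqDU B; pose U n : set T := \big[setU/set0]_(k < n) D k.
have mD k : measurable (D k).
  by apply: measurableD => //; exact: bigsetU_measurable.
have mU n : measurable (U n) by exact: bigsetU_measurable.
have UT : \bigcup_n U n = setT.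
  rewrite -subTset => x _; have [q qx] := rational_points_ball _ x _ r0.
  (* [U n] collects the indices strictly below n, hence the successor. *)
  exists (pickle q).+1 => //; rewrite /U /D -bigsetU_seqDU big_ord_recr/=.
  by right; rewrite /B /rat_point pickleK.
(* The complements decrease to the empty set, so continuity from above makes their finite measures
   tend to 0. *)
have [N mN] : exists N, fine (m (~` U N)) <= e / 2.
  have mC n : measurable (~` U n) by exact: measurableC.
  have IC : \bigcap_n (~` U n) = set0 by rewrite -setC_bigcup UT setCT.
  have : m \o (fun n => ~` U n) @ \oo --> m (\bigcap_n (~` U n)).
    apply: nonincreasing_cvg_mu => //.
    - by rewrite -ge0_fin_numE// fin_num_measure.
    - by rewrite IC.
    - move=> i j ij; apply/subsetPset/subsetC; rewrite /U -!bigsetU_seqDU.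
      exact: subset_bigsetU.
  rewrite IC measure0 => /fine_cvgP[_ /cvgrPdist_lt/(_ (e / 2))].
  have e20 : 0 < e / 2 by rewrite divr_gt0.
  move=> /(_ e20)[N _ /(_ N (leqnn N))]; rewrite /= sub0r normrN => mN.
  by exists N; rewrite (le_trans (ler_norm _))// ltW.
(* By induction on n: on the new piece [D n], inside a ball of radius [r], the Lipschitz estimate
   keeps [f] within d r [|f|] of its value at the centre. *)
have approx n f : `|\int[m]_(x in U n) f x -
    \sum_(k < n) fine (m (D k)) * f (rat_point k)| <=
    d%:R * `|f| * r * fine (m (U n)).
  elim: n => [|n ih].
    rewrite /U !big_ord0 Rintegral_set0 measure0 mulr0 subrr normr0//.
  have UD : U n `&` D n = set0.
    by rewrite /U -bigsetU_seqDU /D /seqDU setIC setDKI.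
  have US : U n.+1 = U n `|` D n by rewrite /U big_ord_recr.
  rewrite US Rintegral_setU//; last first.
  - exact/disj_set2P.
  - by apply: integrableS (holder_integrable m f) => //; exact: measurableU.
  rewrite big_ord_recr/= opprD addrACA measureU//.
  rewrite fineD ?fin_num_measure// mulrDr (le_trans (ler_normD _ _))// lerD//.
  rewrite (mulrC (fine _)); apply: Rintegral_near_cst => //.
    exact: holder_integrable.
  move=> x [Bx _]; rewrite (le_trans (holder_lipschitz _ _ _ _))//.
  rewrite ler_wpM2l ?mulr_ge0// distrC ltW//.
  by move: Bx; rewrite /B -ball_normE.
exists (\sum_(k < N) fine (m (D k)) *: delta alpha (rat_point k)).
  apply: linear_span_sum => k; exists (rat_point k) => //.
  by exists (odflt (0 : 'rV[rat]_d) (unpickle k)).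
move=> f.
have -> : (\sum_(k < N) fine (m (D k)) *: delta alpha (rat_point k)) f =
    \sum_(k < N) fine (m (D k)) * f (rat_point k).
  elim: {mN} N => [|n ih]; first by rewrite !big_ord0.
  by rewrite !big_ord_recr/= -ih -deltaE.
have -> : \int[m]_x f x = \int[m]_(x in U N) f x + \int[m]_(x in ~` U N) f x.
  rewrite -Rintegral_setU//; first by rewrite setUv.
  - exact: measurableC.
  - by rewrite setUv; exact: holder_integrable.
  - by rewrite disj_set2E setICr.
rewrite addrAC (le_trans (ler_normD _ _))//.
(* One half of [e] pays for moving the mass of [U N], the other for dropping the mass outside it. *)
rewrite [e in leRHS](splitr e) mulrDl lerD//.
  rewrite (le_trans (approx _ _))// -mulrA mulrAC ler_wpM2r//.
  apply: (@le_trans _ _ (d%:R * (r * M))).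
    rewrite ler_wpM2l// ler_wpM2l ?(ltW r0)//.
    by rewrite fine_le// ?fin_num_measure// le_measure// inE.
  rewrite mulrCA mulrC /r mulrA ler_pdivrMr// mulrC ler_pM2l ?divr_gt0//.
  by rewrite lerDl.
have := @Rintegral_near_cst _ _ _ m (~` U N) f 0 `|f|
  (measurableC (mU N)) (holder_integrable m f).
rewrite mul0r subr0 => /(_ _)/le_trans -> //.
  by move=> x _; rewrite subr0; exact: holder_bounded.
by rewrite mulrC ler_wpM2r.
Qed.

End measures_approximation.

(** * Density in the closure of the measures, and separability *)

Lemma dual_norm_le {R : realType} {V : normedModType R} (phi : dual V) (M : R) :
  0 <= M -> (forall x, `|phi x| <= M * `|x|) -> `|phi| <= M.
Proof.
move=> M0 phiM; rewrite dual_normE /unit_ball_values.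
apply: (sup_image_le (F := fun x => `|phi x|)) => //= x x1.
by rewrite (le_trans (phiM x))// ler_piMr.
Qed.

Lemma measure_functional_closure {R : realType} {d : nat} {alpha : R}
    (mu : {charge set (borel_rV R d) -> \bar R}) :
  closure (linear_span (delta alpha @` rational_points R d))
    (measure_functional mu).
Proof.
apply/closure_normP => e e0.
(* Two Jordan parts at e / 3 each leave the strict inequality required by the closure. *)
have e30 : 0 < e / 3 by rewrite divr_gt0.
have [phi Sphi phiE] :=
  finite_measure_approx (alpha := alpha) (jordan_pos (hahnP mu)) _ e30.
have [psi Spsi psiE] :=
  finite_measure_approx (alpha := alpha) (jordan_neg (hahnP mu)) _ e30.
exists (phi - psi).
  by apply: linear_spanD => //; rewrite -scaleN1r; exact: linear_spanZ.
apply: (@le_lt_trans _ _ (e / 3 + e / 3)); last by lra.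
apply: dual_norm_le => [|f].
  by rewrite addr_ge0// ltW.
change (`|charge_integral mu f - (phi f - psi f)| <= (e / 3 + e / 3) * `|f|).
rewrite /charge_integral opprD addrACA mulrDl (le_trans (ler_normD _ _))//.
by rewrite lerD// -opprD normrN.
Qed.

(** Open sets of the subtype are traces of open sets of [T], so density in [A] can be checked by
    closures in the ambient space. *)
Lemma dense_set_val {T : topologicalType} (A B : set T) :
  A `<=` closure (A `&` B) -> dense [set z : A | B (set_val z)].
Proof.
move=> AB O [z Oz] [U oU UO].
have Uz : U (set_val z) by move: Oz; rewrite -UO.
have /AB/(_ U)[] : A (set_val z) by exact: set_valP.
  exact: open_nbhs_nbhs.
move=> x [[Ax Bx] Ux]; exists (SigSub (mem_set Ax)).
by split => //; rewrite -UO.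
Qed.

Theorem proposition5p1 (R : realType) (d : nat) (alpha : R) :
  (1 <= d)%N -> 0 < alpha -> alpha <= 1 ->
  let S : set (dual (holder d alpha)) :=
    linear_span (delta alpha @` rational_points R d) in
  [/\ dense [set z : Zspace d alpha | S (set_val z)],
      Zspace d alpha = closure S &
      separable (Zspace d alpha)].
Proof.
move=> _ _ _ S.
have SZ : S `<=` Zspace d alpha.
  by apply: subset_trans (@subset_closure _ _); exact: linear_span_delta_radon.
have ZE : Zspace d alpha = closure S.
  rewrite eqEsubset; split; last first.
    rewrite closureE => z; apply; split; [exact: closed_closure|exact: SZ].
  rewrite /Zspace closureE => z; apply; split; first exact: closed_closure.
  by move=> _ [mu _ <-]; exact: measure_functional_closure.
split => //.
  by apply: dense_set_val; rewrite setIidr// -ZE.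
(* The countable dense set is indexed by finite sequences of pairs of a rational coefficient and a
   rational point, which form a countable type. *)
pose span_of (s : seq (rat * 'rV[rat]_d)) : dual (holder d alpha) :=
  \sum_(p <- s) ratr p.1 *: delta alpha (map_mx ratr p.2).
have DS : range span_of `<=` S.
  move=> _ [s _ <-]; rewrite /span_of (big_nth (0, 0)) big_mkord.
  apply: linear_span_sum => i.
  by exists (map_mx ratr (s`_i).2) => //; exists (s`_i).2.
have DZ s : span_of s \in Zspace d alpha.
  by apply/mem_set/SZ/DS; exists s.
pose D : set (Zspace d alpha) := range (fun s => SigSub (DZ s)).
have DE : D = [set z : Zspace d alpha | range span_of (set_val z)].
  rewrite eqEsubset; split=> [_ [s _ <-]|z [s _ sz]]; first by exists s.
  by exists s => //; exact: val_inj.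
exists D; first exact: sub_countable (card_image_le _ _) (countableP _).
rewrite DE; apply: dense_set_val.
rewrite setIidr; last exact: subset_trans SZ.
(* The closure of the range of [span_of] is closed, so it suffices that it contains [S], where only
   the real coefficients remain to be made rational. *)
rewrite ZE closureE => z; apply; split; first exact: closed_closure.
move=> _ [n [c [a [aA ->]]]].
have /choice[q qa] : forall i, exists q : 'rV[rat]_d,
    delta alpha (map_mx ratr q) = a i.
  by move=> i; have [_ [q _ <-] <-] := aA i; exists q.
have := @closure_rational_span _ _ n c a.
apply: closureS => _ [r _ <-].
exists [seq (r i, q i) | i : 'I_n] => //.
rewrite /span_of big_map big_enum/=.
by apply: eq_bigr => i _; rewrite qa.
Qed.
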